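(* Let $M$ be a maximal translation surface in $\mathbb{L}^3$. If one of its generating curves is planar (contained in an affine plane of $\mathbb{L}^3$), then the other generating curve is also planar.
   Context: $\mathbb{L}^3$ (Lorentz-Minkowski space) is $\mathbb{R}^3$ with the metric $\langle\cdot,\cdot\rangle=dx^2+dy^2-dz^2$. A vector $v$ is spacelike if $\langle v,v\rangle>0$ or $v=0$, timelike if $\langle v,v\rangle<0$, lightlike if $\langle v,v\rangle=0$ and $v\neq0$. A translation surface is a surface parametrized by $X(s,t)=\alpha(s)+\beta(t)$, where $\alpha:I\to\mathbb{L}^3$ and $\beta:J\to\mathbb{L}^3$ are smooth curves on real intervals (the generating curves) and $\alpha'(s),\beta'(t)$ are linearly independent for all $s,t$. A surface is spacelike if its induced metric is Riemannian; then all curves in it are spacelike (spacelike velocity), and the generating curves are parametrized by arc length. A maximal surface is a spacelike surface with mean curvature $H=0$ everywhere; for $X(s,t)=\alpha(s)+\beta(t)$ with $\alpha,\beta$ parametrized by arc length, this is equivalent to $\det(\alpha',\beta',\alpha'')+\det(\alpha',\beta',\beta'')=0$. Standing convention: results are local, and for each generating curve the causal character (spacelike, timelike or lightlike) of its derivatives is the same at all parameter values. *)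

(* Defs.v *)
From mathcomp Require Import all_boot all_order all_algebra.
From mathcomp Require Import all_classical all_reals all_analysis.
From mathcomp Require Import ring.

Set Implicit Arguments.
Unset Strict Implicit.
Unset Printing Implicit Defensive.

Import Order.TTheory GRing.Theory Num.Theory.
Import numFieldNormedType.Exports.

Local Open Scope classical_set_scope.
Local Open Scope ring_scope.

Section LorentzMinkowski.
Variable R : realType.
Implicit Types (u v w : 'rV[R]_3) (a b c : R -> 'rV[R]_3) (I J : set R).
Implicit Types (X : R -> R -> 'rV[R]_3) (s t : R).

Definition ldot u v : R := u 0 0 * v 0 0 + u 0 1 * v 0 1 - u 0 2 * v 0 2.

(* The last component has the opposite of its Euclidean sign, so that
   ldot (lcross u v) w = det (u, v, w). *)
Definition lcross u v : 'rV[R]_3 :=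
  \row_(i < 3)
    [:: u 0 1 * v 0 2 - u 0 2 * v 0 1;
        u 0 2 * v 0 0 - u 0 0 * v 0 2;
        u 0 1 * v 0 0 - u 0 0 * v 0 1]`_i.

Lemma ldot_lcross u v w :
  ldot (lcross u v) w = \det (\matrix_(i < 3) [:: u; v; w]`_i).
Proof.
pose f (x : 'rV[R]_3) (n : nat) : R := x 0 (inord n).
have fE (x : 'rV[R]_3) (i : 'I_3) : x 0 i = f x i by rewrite /f inord_val.
rewrite (expand_det_row _ 0) !big_ord_recl big_ord0 /cofactor.
rewrite !(expand_det_row _ 0) !big_ord_recl !big_ord0 /cofactor !det_mx11.
rewrite /ldot !mxE /= !fE /bump /=.
ring.
Qed.

Definition spacelike v := 0 < ldot v v \/ v = 0.
Definition timelike v := ldot v v < 0.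
Definition lightlike v := ldot v v = 0 /\ v <> 0.

(* Nonempty open intervals, bounded or not. *)
Definition open_itv I := [/\ open I, is_interval I & I !=set0].

(* Curves are total functions, of which only the restriction to the open
   interval I is relevant. *)
Definition smooth_curve I c :=
  forall (k : nat) s, I s -> derivable (derive1n k c) s 1.

Definition unit_speed I c :=
  forall s, I s -> ldot (derive1 c s) (derive1 c s) = 1.

Definition constant_causal I c :=
  [\/ forall s, I s -> spacelike (c s),
      forall s, I s -> timelike (c s) |
      forall s, I s -> lightlike (c s)].

(* The affine plane is p + W, with W given as a row space of dimension 2. *)
Definition planar I c :=
  exists (p : 'rV[R]_3) (W : 'M[R]_3),
    \rank W = 2%N /\ forall s, I s -> (c s - p <= W)%MS.

Definition dvs X s t : 'rV[R]_3 := derive1 (fun s' => X s' t) s.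
Definition dvt X s t : 'rV[R]_3 := derive1 (fun t' => X s t') t.

Definition ffE X s t : R := ldot (dvs X s t) (dvs X s t).
Definition ffF X s t : R := ldot (dvs X s t) (dvt X s t).
Definition ffG X s t : R := ldot (dvt X s t) (dvt X s t).

Definition unit_normal X s t : 'rV[R]_3 :=
  let n := lcross (dvs X s t) (dvt X s t) in
  (Num.sqrt `|ldot n n|)^-1 *: n.

Definition sfe X s t : R := ldot (unit_normal X s t) (dvs (dvs X) s t).
Definition sff X s t : R := ldot (unit_normal X s t) (dvt (dvs X) s t).
Definition sfg X s t : R := ldot (unit_normal X s t) (dvt (dvt X) s t).

(* Mean curvature of a spacelike surface; the leading sign is <N, N> = -1,
   where N is the unit normal. *)
Definition mean_curvature X s t : R :=
  - (sfe X s t * ffG X s t - 2 * sff X s t * ffF X s t + sfg X s t * ffE X s t)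
  / (2 * (ffE X s t * ffG X s t - ffF X s t ^+ 2)).

(* An immersion whose induced metric is positive definite on each tangent
   plane. *)
Definition spacelike_surface I J X :=
  forall s t, I s -> J t ->
    row_free (col_mx (dvs X s t) (dvt X s t)) /\
    forall v, (v <= col_mx (dvs X s t) (dvt X s t))%MS -> v != 0 ->
      0 < ldot v v.

Definition maximal_surface I J X :=
  spacelike_surface I J X /\
  forall s t, I s -> J t -> mean_curvature X s t = 0.

Definition translation a b : R -> R -> 'rV[R]_3 := fun s t => a s + b t.

Definition generating_curves I J a b :=
  [/\ open_itv I, open_itv J, smooth_curve I a, smooth_curve J b &
      forall s t, I s -> J t -> row_free (col_mx (derive1 a s) (derive1 b t))].

End LorentzMinkowski.

(* Main.v *)
Require Import Defs.
From mathcomp Require Import all_boot all_order all_algebra.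
From mathcomp Require Import all_classical all_reals all_analysis.
From mathcomp Require Import ring.

Set Implicit Arguments.
Unset Strict Implicit.
Unset Printing Implicit Defensive.

Import Order.TTheory GRing.Theory Num.Theory.
Import numFieldNormedType.Exports.

Local Open Scope classical_set_scope.
Local Open Scope ring_scope.

(** Write a, b for the velocities of the generating curves, and det (u, v, w)
    for ldot (lcross u v) w.  The vanishing of the mean curvature means
    det (a, b, a' + b') = 0 for all s and t (maximal_translation), and this
    is symmetric in the two curves; so suppose that alpha is planar.  The idea
    is to freeze one parameter s0, which turns the equation into ordinary
    differential equations for beta alone.

    If a and a' are proportional at some s0, then det (a, b, a') = 0, hence
    det (v, b, b') = 0 for all t with the constant vector v = a(s0).  Modulo v
    the direction of b is then constant, and b stays in the plane of v and
    b(t0) (planar_of_pencil).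

    Otherwise fix s0 and put n = lcross a a', the normal of the plane of
    alpha.  The equation at s0 and its derivative in s at s0 are
      det (a, b, b') = f   and   det (a', b, b') = y f,   where f = <n, b>;
    planarity enters in the second one, through a'' = x a + y a'.  So
    v = a' - y a satisfies det (v, b, b') = 0 as well.  This does not suffice
    to conclude, since b could switch from one plane through v to another when
    it meets the line of v.  But where f <> 0, the two determinants and
    <b, b> = 1 give b' = <v, b> b - v (velocity_decomposition).  Since <v, b>
    is the derivative of <v, beta>, for any m orthogonal to v the function
    <m, b> exp (- <v, beta>) has derivative zero.  With m = n this shows that
    f vanishes everywhere, and then beta lies in a plane with normal n, or
    nowhere (level_function_zeros); in the latter case m = lcross v b(t0)
    gives <m, b> = 0 everywhere. *)

(** * Linear algebra of the Lorentz product and cross product *)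

Section LorentzAlgebra.
Variable R : realType.
Implicit Types (u v w p q r : 'rV[R]_3).

Lemma lcrossE u v :
  (lcross u v 0 0 = u 0 1 * v 0 2 - u 0 2 * v 0 1) *
  (lcross u v 0 1 = u 0 2 * v 0 0 - u 0 0 * v 0 2) *
  (lcross u v 0 2 = u 0 1 * v 0 0 - u 0 0 * v 0 1).
Proof. by rewrite /lcross !mxE. Qed.

Lemma row3P u v :
  u 0 0 = v 0 0 -> u 0 1 = v 0 1 -> u 0 2 = v 0 2 -> u = v.
Proof.
move=> e0 e1 e2; apply/rowP => -[[|[|[|//]]] hi].
- by rewrite (_ : Ordinal hi = 0) //; exact: val_inj.
- by rewrite (_ : Ordinal hi = 1) //; exact: val_inj.
- by rewrite (_ : Ordinal hi = 2) //; exact: val_inj.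
Qed.

Lemma ldotC u v : ldot u v = ldot v u.
Proof. by rewrite /ldot; ring. Qed.

Lemma ldotDr u v w : ldot u (v + w) = ldot u v + ldot u w.
Proof. by rewrite /ldot !mxE; ring. Qed.

Lemma ldotZr (x : R) u v : ldot u (x *: v) = x * ldot u v.
Proof. by rewrite /ldot !mxE; ring. Qed.

Lemma ldotNr u v : ldot u (- v) = - ldot u v.
Proof. by rewrite /ldot !mxE; ring. Qed.

Lemma ldot0r u : ldot u 0 = 0.
Proof. by rewrite /ldot !mxE; ring. Qed.

Lemma ldot0l u : ldot 0 u = 0.
Proof. by rewrite ldotC ldot0r. Qed.

Lemma lcrossC u v : lcross u v = - lcross v u.
Proof. by apply: row3P; rewrite !mxE /=; ring. Qed.

Lemma lcross0r u : lcross u 0 = 0.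
Proof. by apply: row3P; rewrite !mxE /=; ring. Qed.

Lemma ldot_lcross_perm u v w : ldot (lcross u v) w = ldot (lcross v w) u.
Proof. by rewrite /ldot !lcrossE; ring. Qed.

Lemma ldot_lcrossl u v : ldot (lcross u v) u = 0.
Proof. by rewrite /ldot !lcrossE; ring. Qed.

Lemma ldot_lcrossr u v : ldot (lcross u v) v = 0.
Proof. by rewrite /ldot !lcrossE; ring. Qed.

Lemma ldot_lcross_lcross u v :
  ldot (lcross u v) (lcross u v) = ldot u v ^+ 2 - ldot u u * ldot v v.
Proof. by rewrite /ldot !lcrossE; ring. Qed.

Lemma ldot_nondegenerate u : u != 0 -> exists w, ldot u w = 1.
Proof.
move=> u0; have [w uw] : exists w, ldot u w != 0.
  apply: contrapT => h; case/eqP: u0; have {}h w : ldot u w = 0.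
    by apply: contrapT => uw; apply: h; exists w; apply/eqP.
  apply: row3P; rewrite mxE.
  - by rewrite -(h (delta_mx 0 0)) /ldot !mxE /=; ring.
  - by rewrite -(h (delta_mx 0 1)) /ldot !mxE /=; ring.
  - by rewrite -(h (- delta_mx 0 2)) /ldot !mxE /=; ring.
by exists ((ldot u w)^-1 *: w); rewrite ldotZr mulVf.
Qed.

(** Cramer's rule for the coordinates of w in the basis p, q, r, multiplied by
    the determinant. *)
Lemma cramer p q r w :
  ldot (lcross p q) r *: w =
    ldot (lcross w q) r *: p + ldot (lcross p w) r *: q
    + ldot (lcross p q) w *: r.
Proof. by apply: row3P; rewrite /ldot !mxE /=; ring. Qed.

(** The same for the basis dual to p, q, r; in particular, a vector orthogonal
    to three independent vectors is zero. *)
Lemma cramer_dual p q r w :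
  ldot (lcross p q) r *: w =
    ldot p w *: lcross q r + ldot q w *: lcross r p + ldot r w *: lcross p q.
Proof. by apply: row3P; rewrite /ldot !mxE /=; ring. Qed.

Lemma coplanarP u v w : lcross u v != 0 -> ldot (lcross u v) w = 0 ->
  exists x y, w = x *: u + y *: v.
Proof.
move=> /ldot_nondegenerate[z uvz] uvw.
exists (ldot (lcross w v) z), (ldot (lcross u w) z).
by have := cramer u v z w; rewrite uvz uvw scale1r scale0r addr0.
Qed.

Lemma coplanar_of_normal n u v w : n != 0 ->
  ldot n u = 0 -> ldot n v = 0 -> ldot n w = 0 -> ldot (lcross u v) w = 0.
Proof.
move=> n0 nu nv nw; apply/eqP/negPn/negP => d0; case/eqP: n0.
apply: (scalerI d0); rewrite scaler0 cramer_dual.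
by rewrite [ldot u n]ldotC [ldot v n]ldotC [ldot w n]ldotC nu nv nw !scale0r !addr0.
Qed.

(** The difference of the two sides is orthogonal to lcross v b, lcross a b
    and b, and these three vectors are linearly independent because their
    determinant is that of a, v, b times ldot b b = 1. *)
Lemma velocity_decomposition a v b b' :
  ldot b b = 1 -> ldot b b' = 0 ->
  ldot (lcross v b) b' = 0 ->
  ldot (lcross a b) b' = ldot (lcross a v) b ->
  ldot (lcross a v) b != 0 ->
  b' = ldot v b *: b - v.
Proof.
move=> bb bb' vbb' abb' avb0.
have det : ldot (lcross (lcross v b) (lcross a b)) b = ldot (lcross a v) b.
  transitivity (ldot (lcross a v) b * ldot b b); last by rewrite bb mulr1.
  by rewrite /ldot !lcrossE; ring.
suff : b' - (ldot v b *: b - v) = 0 by move/eqP; rewrite subr_eq0 => /eqP.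
move: avb0; rewrite -det => det0.
apply: (scalerI det0); rewrite scaler0 cramer_dual.
have abv : ldot (lcross a b) v = - ldot (lcross a v) b.
  by rewrite /ldot !lcrossE; ring.
rewrite !(ldotDr, ldotNr, ldotZr) !ldot_lcrossr ldot_lcrossl.
rewrite vbb' abb' abv bb bb' [ldot b v]ldotC.
by rewrite !(mulr0, mulr1, addr0, add0r, oppr0, opprK, subrr, scale0r, addNr).
Qed.

(** The equation of maximal translation surfaces at one point, with
    p, q for the velocities and p', q' for the accelerations. *)
Lemma maximal_pair p p' q q' : ldot (lcross p q) (p' + q') = 0 ->
  ldot (lcross p q) q' = ldot (lcross p p') q.
Proof.
rewrite ldotDr => /eqP; rewrite addrC addr_eq0 => /eqP ->.
by rewrite /ldot !lcrossE; ring.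
Qed.

(** The derivative of that equation in the parameter of p, for p in a
    fixed plane: the third derivative is x *: p + y *: p'. *)
Lemma maximal_pair_derivative p p' q q' (x y : R) :
  ldot (lcross p' q) (p' + q') + ldot (lcross p q) (x *: p + y *: p') = 0 ->
  ldot (lcross p' q) q' = y * ldot (lcross p p') q.
Proof.
rewrite !(ldotDr, ldotZr) !ldot_lcrossl mulr0 !add0r => /eqP.
by rewrite addr_eq0 => /eqP ->; rewrite /ldot !lcrossE; ring.
Qed.

Lemma ldot_lcross_subl p q r w (y : R) :
  ldot (lcross (p - y *: q) r) w = ldot (lcross p r) w - y * ldot (lcross q r) w.
Proof. by rewrite /ldot !lcrossE !mxE; ring. Qed.

Lemma lcross_subr_scale p q (y : R) : lcross p (q - y *: p) = lcross p q.
Proof. by apply: row3P; rewrite !mxE /=; ring. Qed.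

(** With c = lcross v b and c' = lcross v b1, the hypothesis says that c and c'
    are parallel, so that <c, c> c' = <c, c'> c; the lemma is, up to sign, the
    product of this equality with b0. *)
Lemma pencil_det_quotient v b0 b b1 : ldot (lcross v b) b1 = 0 ->
  ldot (lcross v b0) b1 * ldot (lcross v b) (lcross v b) =
  ldot (lcross v b0) b * ldot (lcross v b) (lcross v b1).
Proof.
move=> vbb1; apply/eqP; rewrite -subr_eq0; apply/eqP.
transitivity (- (ldot (lcross v b) b1 * ldot (lcross v (lcross v b)) b0));
  last by rewrite vbb1 mul0r oppr0.
by rewrite /ldot !lcrossE; ring.
Qed.

End LorentzAlgebra.

(** * Differentiation along curves *)

Section Calculus.
Variable R : realType.
Implicit Types (I J : set R) (s t : R) (u v c : R -> 'rV[R]_3).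

Lemma is_derive_coord (c : R -> 'rV[R]_3) t dc i :
  is_derive t 1 c dc -> is_derive t 1 (fun x => c x 0 i) (dc 0 i).
Proof.
move=> [dct <-]; rewrite derive_mx// mxE; apply: derivableP.
by move/derivable_mxP : dct.
Qed.

Lemma is_derive_ldot u v t du dv :
  is_derive t 1 u du -> is_derive t 1 v dv ->
  is_derive t 1 (fun x => ldot (u x) (v x)) (ldot du (v t) + ldot (u t) dv).
Proof.
move=> Hu Hv.
have Du i := is_derive_coord i Hu; have Dv i := is_derive_coord i Hv.
have := is_deriveB (is_deriveD (is_deriveM (Du 0) (Dv 0))
  (is_deriveM (Du 1) (Dv 1))) (is_deriveM (Du 2) (Dv 2)).
by move=> /is_derive_eq; apply; rewrite /ldot /GRing.scale /=; ring.
Qed.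

Lemma is_derive_ldotr (n : 'rV[R]_3) v t dv :
  is_derive t 1 v dv -> is_derive t 1 (fun x => ldot n (v x)) (ldot n dv).
Proof.
move=> Hv; apply: is_derive_eq (is_derive_ldot (is_derive_cst n t 1) Hv) _.
by rewrite ldot0l add0r.
Qed.

Lemma is_derive_lcross u v t du dv :
  is_derive t 1 u du -> is_derive t 1 v dv ->
  is_derive t 1 (fun x => lcross (u x) (v x)) (lcross du (v t) + lcross (u t) dv).
Proof.
move=> Hu Hv.
have Du i := is_derive_coord i Hu; have Dv i := is_derive_coord i Hv.
have D i j k l := is_deriveB (is_deriveM (Du i) (Dv j)) (is_deriveM (Du k) (Dv l)).
suff H i : is_derive t 1 (fun x => lcross (u x) (v x) 0 i)
    ((lcross du (v t) + lcross (u t) dv) 0 i).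
  have dl : derivable (fun x => lcross (u x) (v x)) t 1.
    by apply/derivable_mxP => j i; rewrite ord1; have [] := H i.
  apply: DeriveDef => //; rewrite derive_mx//; apply/rowP => i.
  by rewrite mxE; have [] := H i.
have E f g df dg : is_derive t (1 : R) f df -> f =1 g -> df = dg ->
    is_derive t (1 : R) (g : R -> R) (dg : R).
  by move=> + /funext <- <-.
case: i => [[|[|[|//]]] hi].
- apply: E (D 1 2 2 1) _ _ => [x|]; rewrite !mxE//= /GRing.scale/=; ring.
- apply: E (D 2 0 0 2) _ _ => [x|]; rewrite !mxE//= /GRing.scale/=; ring.
- apply: E (D 1 0 0 1) _ _ => [x|]; rewrite !mxE//= /GRing.scale/=; ring.
Qed.

Lemma is_derive_lcrossr (n : 'rV[R]_3) v t dv :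
  is_derive t 1 v dv -> is_derive t 1 (fun x => lcross n (v x)) (lcross n dv).
Proof.
move=> Hv; apply: is_derive_eq (is_derive_lcross (is_derive_cst n t 1) Hv) _.
by rewrite lcrossC lcross0r oppr0 add0r.
Qed.

Lemma is_derive_0_interval_cst J (f : R -> R) : is_interval J ->
  (forall t, J t -> is_derive t 1 f 0) -> forall x y, J x -> J y -> f x = f y.
Proof.
move=> itvJ df x y.
wlog xy : x y / x <= y.
  by move=> H Jx Jy; case: (leP x y) => [|/ltW] h; [|apply/esym]; exact: H.
move=> Jx Jy; have dfz z : x <= z <= y -> is_derive z 1 f 0.
  by move=> zxy; apply/df/(itvJ x y).
have [||z _ ] := @MVT_segment R f (fun=> 0) x y xy.
- move=> z; rewrite in_itv/= => /andP[xz zy].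
  by apply: dfz; rewrite !ltW.
- apply: derivable_within_continuous => z; rewrite in_itv/= => zxy.
  by have [] := dfz _ zxy.
by rewrite mul0r => /eqP; rewrite subr_eq0 => /eqP.
Qed.

Lemma is_derive_cst_eq0 I (f : R -> R) d s df : open I -> I s ->
  (forall x, I x -> f x = d) -> is_derive s 1 f df -> df = 0.
Proof.
move=> oI Is fd [_ <-].
have <- := derive_cst d s (1 : R); apply: near_eq_derive.
by have : nbhs s I by [exact: open_nbhs_nbhs]; apply: filterS.
Qed.

Lemma derive1Dcst (c : R -> 'rV[R]_3) w : derive1 (fun x => c x + w) = derive1 c.
Proof.
apply/funext => s; rewrite /derive1; set F := (fun _ : R => _).
set G := (fun _ : R => _); suff -> : F = G by [].
by apply/funext => h; rewrite /F opprD addrACA subrr addr0.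
Qed.

Lemma smooth_is_derive I c k s : smooth_curve I c -> I s ->
  is_derive s 1 (derive1n k c) (derive1n k.+1 c s).
Proof.
by move=> sc Is; rewrite derive1nS derive1E; apply: derivableP; exact: sc.
Qed.

End Calculus.

(** * Planar curves *)

Section Planarity.
Variable R : realType.
Implicit Types (I J : set R) (n v : 'rV[R]_3) (a b c : R -> 'rV[R]_3).

Lemma big_ord3 (F : 'I_3 -> R) : \sum_i F i = F 0 + F 1 + F 2.
Proof.
rewrite !big_ord_recl big_ord0 addr0 addrA.
by congr (F _ + F _ + F _); apply: val_inj.
Qed.

(** The plane p + W is described by one equation: W is the left kernel of its
    cokernel matrix, which has rank 1, so any nonzero column of that matrix is
    a normal. *)
Lemma planar_level_set I c : planar I c ->
  exists n d, n != 0 /\ forall s, I s -> ldot n (c s) = d.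
Proof.
move=> [p [W [rW cW]]].
have : cokermx W != 0 by rewrite -mxrank_eq0 mxrank_coker rW.
have {}cW s : I s -> (c s - p) *m cokermx W = 0.
  by move=> /cW; rewrite submxE => /eqP.
move: (cokermx W) cW => K cW /matrix0Pn[i [j Kij]].
(* The sign turns the Euclidean normal into a Lorentz normal. *)
pose n : 'rV[R]_3 := \row_k [:: K 0 j; K 1 j; - K 2 j]`_k.
have nE w : ldot n w = (w *m K) 0 j by rewrite /ldot !mxE big_ord3 /=; ring.
exists n, (ldot n p); split.
  apply: contra_neq Kij => n0.
  by have := nE (delta_mx 0 i); rewrite n0 ldot0l -rowE mxE => <-.
move=> s Is; apply/eqP; rewrite -subr_eq0 -ldotNr -ldotDr nE.
by rewrite cW // mxE.
Qed.

Lemma level_set_planar I c n d : I !=set0 -> n != 0 ->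
  (forall s, I s -> ldot n (c s) = d) -> planar I c.
Proof.
move=> [s0 Is0] n0 cd.
pose K : 'cV[R]_3 := \col_k [:: n 0 0; n 0 1; - n 0 2]`_k.
have KE (w : 'rV[R]_3) : w *m K = (ldot n w)%:M.
  by apply/rowP => i; rewrite ord1 mxE big_ord3 !mxE /ldot /=; ring.
have K0 : K != 0.
  have [w nw] := ldot_nondegenerate n0; apply: contra_eq_neq nw => K0.
  have := KE w; rewrite K0 mulmx0 => /rowP/(_ 0); rewrite !mxE /= mulr1n => <-.
  by rewrite eq_sym oner_eq0.
exists (c s0), (kermx K); split.
  rewrite mxrank_ker; have := rank_leq_col K.
  by move: K0; rewrite -mxrank_eq0; case: (\rank K) => [|[]].
move=> s Is; rewrite sub_kermx KE ldotDr ldotNr !cd // subrr.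
by apply/eqP/rowP => i; rewrite !mxE mul0rn.
Qed.

Lemma planar_derivatives I c : open I -> smooth_curve I c -> planar I c ->
  exists n, n != 0 /\ forall k s, I s -> ldot n (derive1n k.+1 c s) = 0.
Proof.
move=> oI sc /planar_level_set[n [d [n0 cd]]]; exists n; split=> // k.
suff [e ce] : exists e, forall s, I s -> ldot n (derive1n k c s) = e.
  move=> s Is; apply: (is_derive_cst_eq0 oI Is ce).
  exact: is_derive_ldotr (smooth_is_derive k sc Is).
elim: k => [|k [e ce]]; first by exists d.
exists 0 => s Is; apply: (is_derive_cst_eq0 oI Is ce).
exact: is_derive_ldotr (smooth_is_derive k sc Is).
Qed.

Lemma velocity_planar J b n : open_itv J -> smooth_curve J b -> n != 0 ->
  (forall t, J t -> ldot n (derive1 b t) = 0) -> planar J b.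
Proof.
move=> [_ iJ [t0 Jt0]] sb n0 nb; have neJ : J !=set0 by exists t0.
apply: (level_set_planar neJ n0 (d := ldot n (b t0))) => t Jt.
apply: (is_derive_0_interval_cst (f := fun r => ldot n (b r)) iJ _ Jt Jt0) => r Jr.
by rewrite -(nb r Jr); exact: is_derive_ldotr (smooth_is_derive 0 sb Jr).
Qed.

(** The vector c = lcross v b, with b the velocity, is parallel to its
    derivative and non-null, so that its direction is constant.  This is
    expressed without square roots: for g the determinant of v, the velocity at
    t0 and the velocity at t, the quotient of g ^+ 2 by ldot c c has derivative
    zero, and it is zero at t0. *)
Lemma planar_of_pencil J b v : open_itv J -> smooth_curve J b ->
  (forall t, J t ->
    ldot (lcross v (derive1 b t)) (lcross v (derive1 b t)) != 0) ->
  (forall t, J t -> ldot (lcross v (derive1 b t)) (derive1n 2 b t) = 0) ->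
  planar J b.
Proof.
move=> oJ sb cc0 vbb; have [_ iJ [t0 Jt0]] := oJ.
pose n := lcross v (derive1 b t0).
have n0 : n != 0 by apply: contra_neq (cc0 _ Jt0); rewrite -/n => ->; rewrite ldot0l.
apply: (velocity_planar oJ sb n0) => t Jt; apply/eqP.
pose c r := lcross v (derive1 b r).
pose g r := ldot n (derive1 b r); pose N r := ldot (c r) (c r).
suff : g t * g t * (N t)^-1 = 0.
  by move/eqP; rewrite mulf_eq0 invr_eq0 (negPf (cc0 _ Jt)) orbF mulf_eq0 orbb.
rewrite (_ : 0 = g t0 * g t0 * (N t0)^-1); last first.
  by rewrite {1}/g /n ldot_lcrossr !mul0r.
apply: (is_derive_0_interval_cst (f := fun r => g r * g r * (N r)^-1)
  iJ _ Jt Jt0) => r Jr.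
have Db := smooth_is_derive 1 sb Jr.
have Dg : is_derive r 1 g (ldot n (derive1n 2 b r)) by exact: is_derive_ldotr.
have Dc : is_derive r 1 c (lcross v (derive1n 2 b r)) by exact: is_derive_lcrossr.
pose dg := ldot n (derive1n 2 b r).
pose d := ldot (c r) (lcross v (derive1n 2 b r)).
have DN : is_derive r 1 N (2 * d).
  apply: is_derive_eq (is_derive_ldot Dc Dc) _.
  by rewrite [X in X + _]ldotC mulr_natl mulr2n.
have N0 : N r != 0 := cc0 _ Jr.
have quot : dg * N r = g r * d := pencil_det_quotient (derive1 b t0) (vbb _ Jr).
apply: is_derive_eq (is_deriveM (is_deriveM Dg Dg) (is_deriveV N0 DN)) _.
have quotient_rule (x y z w : R) : x != 0 -> w = y * z / x ->
    (y * y) *: (- x ^- 2 *: (2 * z)) + x^-1 *: (y *: w + y *: w) = 0.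
  by move=> x0 ->; rewrite /GRing.scale /=; field.
exact: quotient_rule N0 (canRL (mulfK N0) quot).
Qed.

(** For f the product of n and the velocity, the hypothesis is f' = <v, b'> f
    multiplied by f, so that it holds trivially at the zeros of f.  An
    integrating factor is exp (- <v, b>).  The square of the product is
    differentiated, because its derivative contains the factor f f', which is
    known also where f vanishes; this avoids any study of the zeros of f. *)
Lemma level_function_zeros J b n v : open_itv J -> smooth_curve J b ->
  (forall t, J t -> ldot n (derive1 b t) * ldot n (derive1n 2 b t) =
                    ldot v (derive1 b t) * ldot n (derive1 b t) ^+ 2) ->
  forall t r, J t -> J r ->
    (ldot n (derive1 b t) == 0) = (ldot n (derive1 b r) == 0).
Proof.
move=> [_ iJ _] sb ode t r Jt Jr.
pose f x := ldot n (derive1 b x); pose e x := expR (ldot (- v) (b x)).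
pose G x := f x * e x.
have G0 x : (f x == 0) = (G x * G x == 0).
  by rewrite mulf_eq0 orbb mulf_eq0 (gt_eqF (expR_gt0 _)) orbF.
suff GG : G t * G t = G r * G r.
  exact: etrans (G0 t) (etrans (congr1 (eq_op^~ 0) GG) (esym (G0 r))).
apply: (is_derive_0_interval_cst (f := fun x => G x * G x) iJ _ Jt Jr) => x Jx.
pose q := ldot v (derive1 b x); pose df := ldot n (derive1n 2 b x).
have Df : is_derive x 1 f df by exact: is_derive_ldotr (smooth_is_derive 1 sb Jx).
have De : is_derive x 1 e (e x * - q).
  rewrite (_ : - q = ldot (- v) (derive1 b x)).
    have Dvb := is_derive_ldotr (- v) (smooth_is_derive 0 sb Jx).
    exact: (is_derive1_comp (f := expR) (is_derive_expR _) Dvb).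
  by rewrite ldotC ldotNr ldotC.
have DG : is_derive x 1 G (e x * (df - q * f x)).
  apply: is_derive_eq (is_deriveM Df De) _; rewrite /GRing.scale /=.
  by move: (f x) (e x) => y z; ring.
apply: is_derive_eq (is_deriveM DG DG) _.
transitivity (2 * e x ^+ 2 * (f x * df - q * f x ^+ 2)).
  rewrite /GRing.scale /= /G; move: (f x) (e x) => y z; ring.
by rewrite ode // subrr mulr0.
Qed.

End Planarity.

(** * Maximal translation surfaces *)

Section TranslationSurface.
Variable R : realType.
Implicit Types (I J : set R) (a b : R -> 'rV[R]_3).

Lemma unit_speed_orthogonal J b t : open J -> smooth_curve J b ->
  unit_speed J b -> J t -> ldot (derive1 b t) (derive1n 2 b t) = 0.
Proof.
move=> oJ sb ub Jt; have Db := smooth_is_derive 1 sb Jt.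
have := is_derive_cst_eq0 oJ Jt ub (is_derive_ldot Db Db).
by rewrite [X in X + _]ldotC -mulr2n => /eqP; rewrite mulrn_eq0 => /eqP.
Qed.

(** Both implications of the theorem are instances: the hypotheses on pairs of
    parameters are symmetric in the two curves, up to the sign of lcross. *)
Lemma planar_generating I J a b :
  open_itv I -> open_itv J -> smooth_curve I a -> smooth_curve J b ->
  unit_speed J b ->
  (forall s t, I s -> J t ->
    ldot (lcross (derive1 a s) (derive1 b t))
         (lcross (derive1 a s) (derive1 b t)) != 0) ->
  (forall s t, I s -> J t ->
    ldot (lcross (derive1 a s) (derive1 b t))
         (derive1n 2 a s + derive1n 2 b t) = 0) ->
  planar I a -> planar J b.
Proof.
move=> oI oJ sa sb ub nn0 eqn plI.
have [openI _ [i0 Ii0]] := oI; have [openJ _ _] := oJ.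
have [[s0 [Is0 curv]]|flat] :=
    pselect (exists s, I s /\ lcross (derive1 a s) (derive1n 2 a s) != 0); last first.
  apply: (planar_of_pencil (v := derive1 a i0) oJ sb) => t Jt; first exact: nn0.
  have a0 : lcross (derive1 a i0) (derive1n 2 a i0) = 0.
    by apply/eqP/negPn/negP => ?; apply: flat; exists i0.
  have := eqn _ _ Ii0 Jt; rewrite ldotDr -[X in X + _]ldot_lcross_perm.
  by rewrite lcrossC a0 oppr0 ldot0l add0r.
set A := derive1 a s0 in curv; set A1 := derive1n 2 a s0 in curv.
set n := lcross A A1 in curv; pose A2 := derive1n 3 a s0.
have nA2 : ldot n A2 = 0.
  have [m [m0 mk]] := planar_derivatives openI sa plI.
  by apply: (coplanar_of_normal m0); [exact: mk 0 _ Is0|exact: mk|exact: mk].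
have [x [y A2E]] := coplanarP curv nA2.
pose v := A1 - y *: A.
have first t : J t -> ldot (lcross A (derive1 b t)) (derive1n 2 b t) =
    ldot n (derive1 b t).
  by move=> Jt; exact: maximal_pair (eqn _ _ Is0 Jt).
have second t : J t -> ldot (lcross A1 (derive1 b t)) (derive1n 2 b t) =
    y * ldot n (derive1 b t).
  move=> Jt.
  have DA := smooth_is_derive 1 sa Is0; have DA1 := smooth_is_derive 2 sa Is0.
  have := is_derive_ldot (is_derive_lcross DA (is_derive_cst (derive1 b t) s0 1))
    (is_deriveD DA1 (is_derive_cst (derive1n 2 b t) s0 1)).
  move=> /(is_derive_cst_eq0 openI Is0 (fun s Is => eqn s t Is Jt)).
  by rewrite lcross0r !addr0 -/A2 A2E; exact: maximal_pair_derivative.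
(* From here on only the linear relations between A, A1, A2 matter; v is the
   combination for which the right-hand sides of first and second cancel. *)
clearbody A A1 A2.
have pencil t : J t -> ldot (lcross v (derive1 b t)) (derive1n 2 b t) = 0.
  move=> Jt; apply: etrans (ldot_lcross_subl _ _ _ _ _) _.
  by rewrite (first _ Jt) (second _ Jt) subrr.
have nE : lcross A v = n by exact: lcross_subr_scale.
have nv : ldot n v = 0 by rewrite -nE ldot_lcrossr.
have [[t0 [Jt0 f0]]|plane] :=
    pselect (exists t, J t /\ ldot n (derive1 b t) != 0); last first.
  apply: (velocity_planar oJ sb curv) => t Jt.
  by apply/eqP/negPn/negP => ?; apply: plane; exists t.
have ode t : J t -> ldot n (derive1 b t) != 0 ->
    derive1n 2 b t = ldot v (derive1 b t) *: derive1 b t - v.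
  move=> Jt f; have bb' := unit_speed_orthogonal openJ sb ub Jt.
  by apply: (velocity_decomposition (a := A) (ub _ Jt) bb' (pencil _ Jt)); rewrite nE;
    [exact: first|exact: f].
have nonzero t : J t -> ldot n (derive1 b t) != 0.
  (* The formula ode is known only where f is nonzero, which suffices here. *)
  move=> Jt; rewrite (level_function_zeros (v := v) oJ sb _ Jt Jt0); first exact: f0.
  move=> r Jr; have [->|f] := eqVneq (ldot n (derive1 b r)) 0.
    by rewrite mul0r expr0n mulr0.
  by rewrite {1}(ode _ Jr f) ldotDr ldotZr ldotNr nv; ring.
pose m := lcross v (derive1 b t0).
have m0 : m != 0.
  apply: contra_neq f0 => m0.
  by rewrite -nE ldot_lcross_perm -/m m0 ldot0l.
apply: (velocity_planar oJ sb m0) => t Jt; apply/eqP.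
rewrite (level_function_zeros (v := v) oJ sb _ Jt Jt0); first by rewrite ldot_lcrossr.
move=> r Jr; rewrite (ode _ Jr (nonzero _ Jr)) ldotDr ldotZr ldotNr ldot_lcrossl.
by ring.
Qed.

Lemma dvs_translation a b : dvs (translation a b) = fun s _ => derive1 a s.
Proof. by apply/funext => s; apply/funext => t; rewrite /dvs derive1Dcst. Qed.

Lemma dvt_translation a b : dvt (translation a b) = fun _ t => derive1 b t.
Proof.
apply/funext => s; apply/funext => t; rewrite /dvt -(derive1Dcst b (a s)).
by congr (derive1 _ t); apply/funext => r; rewrite addrC.
Qed.

(** The Gram determinant is the square of the component of w orthogonal to u,
    which is a nonzero vector of the spacelike tangent plane. *)
Lemma spacelike_gram_gt0 (u w : 'rV[R]_3) : ldot u u = 1 -> ldot w w = 1 ->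
  row_free (col_mx u w) ->
  (forall z, (z <= col_mx u w)%MS -> z != 0 -> 0 < ldot z z) ->
  0 < 1 - ldot u w ^+ 2.
Proof.
move=> uu ww free pos; pose z := w - ldot u w *: u.
have -> : 1 - ldot u w ^+ 2 = ldot z z.
  transitivity (ldot w w - 2 * ldot u w ^+ 2 + ldot u w ^+ 2 * ldot u u).
    by rewrite uu ww; ring.
  by rewrite /z /ldot !mxE; ring.
have zE : z = row_mx (- (ldot u w)%:M) 1%:M *m col_mx u w.
  by rewrite mul_row_col mul1mx mulNmx mul_scalar_mx addrC.
apply: pos; first by rewrite zE submxMl.
apply/eqP => z0; have /eqP := zE; rewrite z0 eq_sym mulmx_free_eq0 //.
move=> /eqP/rowP/(_ (rshift 1 0)); rewrite row_mxEr !mxE /= => /eqP.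
by rewrite oner_eq0.
Qed.

(** The mixed second derivative vanishes and both curves have unit speed, so
    that the numerator of the mean curvature is, up to sign, the product of the
    unit normal and the sum of the accelerations.  The normal is non-null
    because its square is minus the Gram determinant. *)
Lemma maximal_translation I J a b s t : maximal_surface I J (translation a b) ->
  unit_speed I a -> unit_speed J b -> I s -> J t ->
  ldot (lcross (derive1 a s) (derive1 b t))
       (lcross (derive1 a s) (derive1 b t)) != 0 /\
  ldot (lcross (derive1 a s) (derive1 b t))
       (derive1n 2 a s + derive1n 2 b t) = 0.
Proof.
move=> [sp H0] ua ub Is Jt; have [free pos] := sp _ _ Is Jt.
have := H0 _ _ Is Jt; move: free pos.
rewrite /mean_curvature /sfe /sff /sfg /ffE /ffF /ffG /unit_normal.
rewrite dvs_translation dvt_translation.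
have -> : dvs (fun s' _ => derive1 a s') s t = derive1n 2 a s by [].
have -> : dvt (fun s' _ => derive1 a s') s t = 0 by exact: derive1_cst.
have -> : dvt (fun _ t' => derive1 b t') s t = derive1n 2 b t by [].
have := ua _ Is; have := ub _ Jt.
move: (derive1n 2 a s) (derive1n 2 b t) (derive1 a s) (derive1 b t).
move=> p' q' p q qq pp free pos.
have gram := spacelike_gram_gt0 pp qq free pos.
set N := lcross p q; have N0 : ldot N N != 0.
  by rewrite ldot_lcross_lcross pp qq mulr1 -opprB oppr_eq0 gt_eqF.
rewrite ldot0r mulr0 mul0r subr0 pp qq !mulr1.
move=> /eqP; rewrite mulf_eq0 invr_eq0 mulf_eq0 pnatr_eq0 (gt_eqF gram) !orbF.
rewrite oppr_eq0 -ldotDr ldotC ldotZr mulf_eq0 invr_eq0 sqrtr_eq0.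
by rewrite normr_le0 (negPf N0) /= ldotC => /eqP.
Qed.

End TranslationSurface.

Theorem theorem1p1 (R : realType) (I J : set R) (alpha beta : R -> 'rV[R]_3)
    (hgen : generating_curves I J alpha beta)
    (hmax : maximal_surface I J (translation alpha beta))
    (halpha : unit_speed I alpha) (hbeta : unit_speed J beta)
    (calpha : forall k : nat, (0 < k)%N -> constant_causal I (derive1n k alpha))
    (cbeta : forall k : nat, (0 < k)%N -> constant_causal J (derive1n k beta)) :
  (planar I alpha -> planar J beta) /\ (planar J beta -> planar I alpha).
Proof.
have [oI oJ sa sb _] := hgen.
have H s t := @maximal_translation R I J alpha beta s t hmax halpha hbeta.
split.
  by apply: planar_generating => // s t Is Jt; have [] := H s t Is Jt.
apply: planar_generating => // t s Jt Is; have [nn0 eqn] := H s t Is Jt.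
- by rewrite ldot_lcross_lcross ldotC mulrC -ldot_lcross_lcross.
- by rewrite lcrossC ldotC ldotNr ldotC addrC eqn oppr0.
Qed.
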